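(* Let $R$ be a unital ring with involution and let $a\in R$. Then the following are equivalent: (1) $a\in R^{\mathrm{EP}}$; (2) $a\in R^{\mathrm{core}}$ and $(a^{\mathrm{core}}a)^*=a^{\mathrm{core}}a$; (3) $a\in R^{\mathrm{core}}$ and $(a^{\mathrm{core}})^{\mathrm{core}}=a$; (4) $a\in R^{\mathrm{core}}$ and $(a^{\mathrm{core}})^{\dagger}=a$; (5) $a\in R^{\mathrm{core}}$ and $(a^{\mathrm{core}})^{\#}=a$; (6) $a\in R^{\dagger}\cap R^{\#}$ and $(a^{\dagger})^{\mathrm{core}}=a$; (7) $a\in R^{\dagger}\cap R^{\#}$ and $(a^{\dagger})^{\mathrm{core}}=(a^{\mathrm{core}})^{\dagger}$; (8) $a\in R^{\mathrm{core}}$ and $ap=0$, where $p=1-aa^{\mathrm{core}}$.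
   Context: A unital (associative, not necessarily commutative) ring with involution is a unital ring $R$ with a map $a\mapsto a^*$ satisfying $(a^* )^*=a$, $(ab)^*=b^*a^*$, $(a+b)^*=a^*+b^*$ for all $a,b\in R$. The Moore-Penrose inverse of $a\in R$ is the element $a^\dagger=x$ (unique if it exists) with $axa=a$, $xax=x$, $(ax)^*=ax$, $(xa)^*=xa$; $R^\dagger$ is the set of Moore-Penrose invertible elements. The group inverse of $a$ is the element $a^\#=x$ (unique if it exists) with $axa=a$, $xax=x$, $ax=xa$; $R^\#$ is the set of group invertible elements. $R^{\mathrm{EP}}$ is the set of EP elements: those $a\in R^\dagger\cap R^\#$ with $a^\dagger=a^\#$. The core inverse of $a$ is the element $a^{\mathrm{core}}=x$ (unique if it exists) with $axa=a$, $xR=aR$ and $Rx=Ra^*$, where $aR=\{ar:r\in R\}$, $Ra=\{ra:r\in R\}$; $R^{\mathrm{core}}$ is the set of core invertible elements. An equality involving some generalized inverse is understood to include the assertion that this inverse exists (it is known that $R^\dagger\cap R^{\mathrm{core}}=R^\dagger\cap R^\#$, and that $a^{\mathrm{core}}$ is always itself EP). *)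

(* Defs.v *)
From HB Require Import structures.
From mathcomp Require Import all_boot ssralg.

Set Implicit Arguments.
Unset Strict Implicit.
Unset Printing Implicit Defensive.

Import GRing.Theory.
Local Open Scope ring_scope.

(* The base class is PzRing: associative and unital, not assumed commutative,
   and possibly the zero ring. *)
HB.mixin Record PzRing_hasStar R of GRing.PzRing R := {
  star : R -> R;
  starK : forall a : R, star (star a) = a;
  starM : forall a b : R, star (a * b) = star b * star a;
  starD : forall a b : R, star (a + b) = star a + star b
}.

#[short(type="starRingType")]
HB.structure Definition StarRing := {R of PzRing_hasStar R & GRing.PzRing R}.

(* The generalized inverses are partial operations. Each one is represented by
   its graph: "X_inverse a x" says that the X-inverse of a exists and equals x.
   The uniqueness lemmas below show that the graphs are functional. *)

Definition MP_inverse (R : starRingType) (a x : R) : Prop :=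
  [/\ a * x * a = a, x * a * x = x,
      star (a * x) = a * x & star (x * a) = x * a].

Definition group_inverse (R : starRingType) (a x : R) : Prop :=
  [/\ a * x * a = a, x * a * x = x & a * x = x * a].

Definition right_ideal (R : starRingType) (a z : R) : Prop :=
  exists r : R, z = a * r.

Definition left_ideal (R : starRingType) (a z : R) : Prop :=
  exists r : R, z = r * a.

Definition core_inverse (R : starRingType) (a x : R) : Prop :=
  [/\ a * x * a = a,
      forall z : R, right_ideal x z <-> right_ideal a z &
      forall z : R, left_ideal x z <-> left_ideal (star a) z].

Definition MP_invertible (R : starRingType) (a : R) : Prop :=
  exists x : R, MP_inverse a x.

Definition group_invertible (R : starRingType) (a : R) : Prop :=
  exists x : R, group_inverse a x.

Definition EP (R : starRingType) (a : R) : Prop :=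
  exists x y : R, [/\ MP_inverse a x, group_inverse a y & x = y].

Lemma MP_inverse_unique (R : starRingType) (a x y : R) :
  MP_inverse a x -> MP_inverse a y -> x = y.
Proof.
move=> [axa xax sax sxa] [aya yay say sya].
have eax : a * x = a * y.
  by rewrite -sax -{1}aya -mulrA starM sax say mulrA axa.
have exa : x * a = y * a.
  by rewrite -sxa -{1}aya -[a * y * a]mulrA mulrA starM sxa sya -mulrA [a * _]mulrA axa.
by rewrite -xax exa -mulrA eax mulrA yay.
Qed.

Lemma group_inverse_unique (R : starRingType) (a x y : R) :
  group_inverse a x -> group_inverse a y -> x = y.
Proof.
move=> [axa xax cx] [aya yay cy].
have e : a * x = a * y.
  transitivity (a * y * (a * x)); first by rewrite mulrA aya.
  by rewrite cx cy -mulrA [a * (x * a)]mulrA axa.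
by rewrite -xax -cx e cy -mulrA e mulrA yay.
Qed.

Lemma core_inverseE (R : starRingType) (a x : R) : core_inverse a x ->
  [/\ a * x * a = a, x * a * x = x, star (a * x) = a * x,
      x * a * a = a & a * x * x = x].
Proof.
move=> [axa rx lx].
have [s xs] : left_ideal (star a) x by apply/lx; exists 1; rewrite mul1r.
have [u xu] : right_ideal a x by apply/rx; exists 1; rewrite mulr1.
have [v av] : right_ideal x a by apply/rx; exists 1; rewrite mulr1.
have xE : x * star (a * x) = x.
  by rewrite {1}xs -mulrA -starM axa -xs.
have sax : star (a * x) = a * x.
  have e : a * x * star (a * x) = a * x by rewrite -mulrA xE.
  by rewrite -{1}e starM starK e.
have xax : x * a * x = x by rewrite -mulrA -{1}sax xE.
split=> //; first by rewrite {2}av mulrA xax -av.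
by rewrite {2}xu mulrA axa -xu.
Qed.

Lemma core_inverse_unique (R : starRingType) (a x y : R) :
  core_inverse a x -> core_inverse a y -> x = y.
Proof.
move=> /core_inverseE[axa xax sax xaa axx] /core_inverseE[aya yay say yaa ayy].
have e : a * x = a * y.
  by rewrite -sax -{1}aya -mulrA starM sax say mulrA axa.
by rewrite -xax -mulrA e -{1}ayy !mulrA xaa ayy.
Qed.

(* Main.v *)
Require Import Defs.
From mathcomp Require Import all_boot ssralg.

(** All eight conditions say in disguise that [a] has an inverse [x] which
    is its Moore-Penrose inverse and commutes with it ([EP_commP]). That
    situation is symmetric in [a] and [x], and it makes [x] the Moore-Penrose,
    group and core inverse of [a] at once ([commuting_MP_core]), so it yields
    every one of the conditions with the same witness [x]. The cycle of
    implications thus always passes through EP: each condition yields a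
    commuting inverse, which then serves as the witness for the next.

    Conversely, for a core inverse [x] of [a] put [e := a * x] and [f := x * a].
    These are idempotents with [f * e = e] and [e * f = f], and [e] is
    self-adjoint. If [f] is self-adjoint too, taking adjoints gives [e = f]
    ([core_inverse_selfadjoint_EP]). Conditions (2), (3) and (4) contain the
    self-adjointness of [f], and so does (6), where the Moore-Penrose inverse of
    [a] turns out to be its core inverse ([MP_core_sym]). Condition (5) contains
    [e = f], and (8) says [a * e = a], whence [f = f * e = e].

    Condition (7) is the only one comparing two different inverses: there the
    projections to identify are [a * x] and [y * a], with [y] the Moore-Penrose
    inverse of [a]. Since [x] has Moore-Penrose inverse [a * a * x], the
    hypothesis makes this element the core inverse of [y], and hence
    [a * x] and [y * a] have the same range
    ([EP_of_core_MP_eq_MP_core]). *)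

Local Open Scope ring_scope.
Import GRing.Theory.

(** A self-adjoint projection is determined by its range: for idempotents the two
    absorption hypotheses say that [e] and [f] have the same range. *)
Lemma selfadjoint_absorb_eq (R : starRingType) (e f : R) :
  star e = e -> star f = f -> e * f = f -> f * e = e -> e = f.
Proof. by move=> se sf ef fe; rewrite -ef -{1}se -{1}fe starM se sf. Qed.

(** The five equations of [core_inverseE] also recover the equalities of one-sided
    ideals, so that core inverses can be recognized by computation. *)
Lemma core_inverse_of_eqs (R : starRingType) (a x : R) :
  [/\ a * x * a = a, x * a * x = x, star (a * x) = a * x,
      x * a * a = a & a * x * x = x] -> core_inverse a x.
Proof.
move=> [axa xax sax xaa axx]; split=> // z; split=> -[r ->].
- by exists (x * x * r); rewrite !mulrA axx.
- by exists (a * a * r); rewrite !mulrA xaa.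
- by exists (r * x * star x); rewrite -!mulrA -starM sax !mulrA -!(mulrA r) xax.
- by exists (r * star a * a); rewrite -!mulrA -sax -starM axa.
Qed.

Lemma MP_inverse_sym (R : starRingType) (a x : R) :
  MP_inverse a x -> MP_inverse x a.
Proof. by case. Qed.

Lemma commuting_MP_group (R : starRingType) (a x : R) :
  MP_inverse a x -> a * x = x * a -> group_inverse a x.
Proof. by case. Qed.

Lemma commuting_MP_core (R : starRingType) (a x : R) :
  MP_inverse a x -> a * x = x * a -> core_inverse a x.
Proof.
move=> [axa xax sax sxa] ax_xa; apply: core_inverse_of_eqs.
by split=> //; [rewrite -ax_xa | rewrite ax_xa].
Qed.

Lemma EP_commP (R : starRingType) (a : R) :
  EP a <-> exists2 x : R, MP_inverse a x & a * x = x * a.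
Proof.
split=> [[x [y [MPx [_ _ ay_ya] xy]]] | [x MPx ax_xa]].
  by exists x => //; rewrite xy.
by exists x, x; split=> //; apply: commuting_MP_group.
Qed.

Lemma core_inverse_comm_EP (R : starRingType) (a x : R) :
  core_inverse a x -> a * x = x * a -> EP a.
Proof.
move=> /core_inverseE[axa xax sax _ _] ax_xa; apply/EP_commP.
by exists x => //; split=> //; rewrite -ax_xa.
Qed.

(** [a * x] and [x * a] are idempotents with the same range; being self-adjoint
    as well, they are equal. *)
Lemma core_inverse_selfadjoint_EP (R : starRingType) (a x : R) :
  core_inverse a x -> star (x * a) = x * a -> EP a.
Proof.
move=> cx sxa; apply: (core_inverse_comm_EP _ _ _ cx).
have [_ _ sax xaa axx] := core_inverseE cx.
by apply: selfadjoint_absorb_eq; rewrite // mulrA ?axx ?xaa.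
Qed.

(** If [a] is the core inverse of its Moore-Penrose inverse [y], then [y] is the
    core inverse of [a]: the core equations for [(y, a)] differ from those for
    [(a, y)] only in which of [a * y] and [y * a] is self-adjoint, and the
    Moore-Penrose inverse supplies both. *)
Lemma MP_core_sym (R : starRingType) (a y : R) :
  MP_inverse a y -> core_inverse y a -> core_inverse a y.
Proof.
move=> [aya yay say _] /core_inverseE[_ _ _ ayy yaa].
by apply: core_inverse_of_eqs.
Qed.

(** The Moore-Penrose inverse of [x] has to lie in the corner cut out by the
    projection [a * x], on which [x] is invertible; this is [a] compressed to
    that corner. *)
Lemma core_inverse_MP (R : starRingType) (a x : R) :
  core_inverse a x -> MP_inverse x (a * a * x).
Proof.
move=> /core_inverseE[axa xax sax xaa axx].
have xu : x * (a * a * x) = a * x by rewrite !mulrA xaa.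
have ux : a * a * x * x = a * x by rewrite -!mulrA (mulrA a x) axx.
by split; rewrite ?xu ?ux // !mulrA axa.
Qed.

(** With [u := a * a * x] the core inverse of [y], the ranges of [y] and [u] agree,
    and that of [u] is the range of [a]. Hence the projections [a * x] and
    [y * a] have the same range and coincide; so do [a * x] and [a * y], both
    being the projection onto the range of [a]. *)
Lemma EP_of_core_MP_eq_MP_core (R : starRingType) (a x y u : R) :
  MP_inverse a y -> core_inverse a x ->
  core_inverse y u -> MP_inverse x u -> EP a.
Proof.
move=> MPy cx cy MPu.
have uE : u = a * a * x := MP_inverse_unique MPu (core_inverse_MP _ _ _ cx).
have [aya yay say sya] := MPy.
have [axa xax sax xaa axx] := core_inverseE cx.
have [_ _ _ uyy yuu] := core_inverseE cy.
have uxa : u * x * a = a.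
  by rewrite uE -(mulrA a a) -(mulrA a (a * x)) axx.
have axu : a * x * u = u by rewrite uE !mulrA axa.
have axy : a * x * y = y by rewrite -{1}uyy !mulrA axu uyy.
have yaa : y * a * a = a.
  by rewrite -{2}uxa -{1}yuu !mulrA yay yuu uxa.
have ax_ya : a * x = y * a.
  by apply: selfadjoint_absorb_eq => //; rewrite mulrA ?axy ?yaa.
have ax_ay : a * x = a * y.
  by apply: selfadjoint_absorb_eq => //; rewrite mulrA ?axa ?aya.
by apply/EP_commP; exists y => //; rewrite -ax_ay.
Qed.

Theorem theorem3p7 (R : starRingType) (a : R) :
  [<-> (* 1 *) EP a;
       (* 2 *) exists2 x : R, core_inverse a x & star (x * a) = x * a;
       (* 3 *) exists2 x : R, core_inverse a x & core_inverse x a;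
       (* 4 *) exists2 x : R, core_inverse a x & MP_inverse x a;
       (* 5 *) exists2 x : R, core_inverse a x & group_inverse x a;
       (* 6 *) [/\ MP_invertible a, group_invertible a &
                exists2 y : R, MP_inverse a y & core_inverse y a];
       (* 7 *) [/\ MP_invertible a, group_invertible a &
                exists x y u v : R,
                  [/\ MP_inverse a y, core_inverse y u,
                      core_inverse a x, MP_inverse x v & u = v]];
       (* 8 *) exists2 x : R, core_inverse a x &
                let p := 1 - a * x in a * p = 0].
Proof.
tfae.
- move=> /EP_commP[x MPx ax_xa]; exists x; first exact: commuting_MP_core.
  by case: MPx.
- move=> [x cx sxa].
  have /EP_commP[y MPy ay_ya] := core_inverse_selfadjoint_EP _ _ _ cx sxa.
  by exists y; apply: commuting_MP_core => //; apply: MP_inverse_sym.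
- move=> [x cx /core_inverseE[_ _ sxa _ _]].
  have /EP_commP[y MPy ay_ya] := core_inverse_selfadjoint_EP _ _ _ cx sxa.
  by exists y; [apply: commuting_MP_core | apply: MP_inverse_sym].
- move=> [x cx [_ _ sxa _]].
  have /EP_commP[y MPy ay_ya] := core_inverse_selfadjoint_EP _ _ _ cx sxa.
  exists y; first exact: commuting_MP_core.
  by apply: commuting_MP_group => //; apply: MP_inverse_sym.
- move=> [x cx [_ _ xa_ax]].
  have /EP_commP[y MPy ay_ya] := core_inverse_comm_EP _ _ _ cx (esym xa_ax).
  split; first by exists y.
    by exists y; apply: commuting_MP_group.
  by exists y => //; apply: commuting_MP_core => //; apply: MP_inverse_sym.
- move=> [MPa ga [y MPy cy]]; split=> //.
  have [_ _ _ sya] := MPy.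
  have /EP_commP[x MPx ax_xa] :=
    core_inverse_selfadjoint_EP _ _ _ (MP_core_sym _ _ _ MPy cy) sya.
  exists x, x, a, a; split=> //; last exact: MP_inverse_sym.
    by apply: commuting_MP_core => //; apply: MP_inverse_sym.
  exact: commuting_MP_core.
- move=> [_ _ [x [y [u [v [MPy cy cx MPv uv]]]]]]; rewrite -{}uv in MPv.
  have /EP_commP[z MPz az_za] := EP_of_core_MP_eq_MP_core _ _ _ _ _ MPy cx cy MPv.
  exists z => /=; first exact: commuting_MP_core.
  by have [aza _ _ _] := MPz; rewrite mulrBr mulr1 az_za mulrA aza subrr.
- move=> [x cx /= ap0]; apply: (core_inverse_comm_EP _ _ _ cx).
  have aax : a * (a * x) = a.
    by apply/esym/eqP; rewrite -subr_eq0 -{1}[a]mulr1 -mulrBr ap0.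
  have [_ _ _ xaa _] := core_inverseE cx.
  by rewrite -{2}aax !mulrA xaa.
Qed.
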